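(* The equation $$\frac{I_\nu(\sqrt{5-2\nu})}{I_{\nu-1}(\sqrt{5-2\nu})}=\frac{3-2\nu}{\sqrt{5-2\nu}}$$ has a unique solution $\nu=\nu_0$ in the interval $(1/2,3/2)$, with $\nu_0\approx 0.78449776$; and, for $\nu>0$, the function $t\mapsto f_{\nu,a}(t)$ is log-concave on $(0,\infty)$ for all $a\ge 0$ if and only if $\nu\ge\nu_0$.
   Context: For $\mu>-1$ and $t>0$, the modified Bessel function of the first kind is $I_\mu(t)=\sum_{k=0}^\infty \frac{(t/2)^{2k+\mu}}{k!\,\Gamma(\mu+k+1)}$. For $\nu>0$, $a\ge 0$ and $t>0$, $f_{\nu,a}$ denotes the integrand in the definition $Q_\nu(a,b)=\int_b^\infty f_{\nu,a}(t)\,dt$ of the generalized Marcum Q function: $$f_{\nu,a}(t)=\frac{t^\nu}{a^{\nu-1}}\exp\left(-\frac{t^2+a^2}{2}\right)I_{\nu-1}(at),$$ where for $a=0$ the expression is defined by the limit $a\downarrow 0$, i.e. $f_{\nu,0}(t)=\frac{t^{2\nu-1}}{2^{\nu-1}\Gamma(\nu)}e^{-t^2/2}$. A nonnegative function $g$ on an interval $J$ is log-concave if $g(\lambda x+(1-\lambda)y)\ge g(x)^\lambda g(y)^{1-\lambda}$ for all $x,y\in J$, $\lambda\in(0,1)$. *)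

(* Defs.v *)
From Stdlib Require Import Reals Factorial.
From Coquelicot Require Import Coquelicot.
Open Scope R_scope.

(* Improper at both ends; meaningful for [x > 0]. *)
Definition Gamma (x : R) : R :=
  RInt_gen (fun t => Rpower t (x - 1) * exp (- t))
    (at_right 0) (Rbar_locally p_infty).

Definition besselI (mu t : R) : R :=
  Series (fun k : nat =>
    Rpower (t / 2) (2 * INR k + mu) / (INR (fact k) * Gamma (mu + INR k + 1))).

(* The integrand of the generalized Marcum Q function
   Q_nu(a,b) = int_b^oo f_{nu,a}(t) dt; the first branch is the limit of the
   second one as [a] decreases to 0. *)
Definition marcum_integrand (nu a t : R) : R :=
  if Req_EM_T a 0
  then Rpower t (2 * nu - 1) / (Rpower 2 (nu - 1) * Gamma nu) * exp (- (t ^ 2 / 2))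
  else Rpower t nu / Rpower a (nu - 1) * exp (- ((t ^ 2 + a ^ 2) / 2))
       * besselI (nu - 1) (a * t).

(* [x ^ y] for [x >= 0] and [y > 0], with [0 ^ y = 0]; the library's [Rpower]
   is exp (y * ln x), which equals 1 at [x = 0] since [ln 0 = 0]. *)
Definition nonneg_power (x y : R) : R :=
  if Rlt_dec 0 x then Rpower x y else 0.

Definition log_concave_on (J : R -> Prop) (g : R -> R) : Prop :=
  (forall x, J x -> 0 <= g x) /\
  (forall x y lambda, J x -> J y -> 0 < lambda < 1 ->
     nonneg_power (g x) lambda * nonneg_power (g y) (1 - lambda)
       <= g (lambda * x + (1 - lambda) * y)).

(* Main.v *)
Require Import Defs.
From Stdlib Require Import Reals.
From Coquelicot Require Import Coquelicot.
From Stdlib Require Import Factorial Ranalysis5 Lra Lia.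
Open Scope R_scope.

(** Write [c = 2 nu - 1], [z = (a t)^2 / 4] and [phi z = sum_k z^k / (k! (nu)_k)],
    with [(nu)_k] the rising factorial. Up to the factor [z^((nu-1)/2) / Gamma nu],
    [phi] is [I_{nu-1}] at [2 sqrt z] and [z^(1/2) phi'] is [I_nu]. For every
    [a >= 0], the case [a = 0] included, the integrand is a positive constant times
    the exponential of [c ln t - t^2/2 + ln (phi z)] ([marcum_integrand_exp]).

    With [rho = 2 z phi' / phi], the differential equation
    [z phi'' + nu phi' = phi] becomes a Riccati equation for [rho], and the second
    derivative of that exponent is [- D(z) / t^2 - 1], where
    [D = rho^2 + c (rho + 1) - 4 z] ([defect]). Letting [t] tend to [0] with [z]
    fixed removes the [-1]: log-concavity for all [a] means [D z >= 0] for all [z >= 0]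
    ([log_concave_iff_defect]).

    The Riccati equation makes [D] solve a linear first-order equation, so that
    [W = z^(nu - 3/2) phi^2 D] ([weighted_defect]) has a derivative with the sign of
    [c S(z)], where [S = 2 z phi' - (3 - 2 nu) phi] ([crossing]). For [nu >= 1/2],
    [S] is nondecreasing. Hence:
    - if [nu >= 3/2], then [S >= 0], [W] is nondecreasing, and [D > 0] near [0], so
      [D >= 0] everywhere;
    - if [1/2 < nu < 3/2], then [W] is minimal at a zero [w] of [S]. There
      [rho = 3 - 2 nu] and [D(w) = 5 - 2 nu - 4 w], so that [D >= 0] everywhere
      exactly when [w <= (5 - 2 nu) / 4], that is, when [S((5 - 2 nu) / 4) >= 0]
      ([defect_nonneg_iff_crossing]);
    - if [nu <= 1/2], then [D < 0] at small [z > 0] ([defect_neg_of_le]).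

    The equation of the theorem is exactly [S((5 - 2 nu) / 4) = 0]
    ([bessel_equation_iff]). Multiplied by [nu (nu + 1)], its left side is an
    explicit cubic plus a rapidly convergent positive series
    ([scaled_crossing_eq]). This sum is negative for [1/2 < nu <= 7/10]; for
    [7/10 <= nu <= 3/2] it is strictly increasing, because the slope of the cubic exceeds
    the Lipschitz constant of the series ([scaled_crossing_lt]). So it has
    one zero, at which it changes sign from negative to positive; a few
    terms of the series at the two ends of an interval of length [10^-8] locate it. *)

(** * The Gamma function on the positive half-line *)

(** The integrals over compact subintervals grow with the subinterval, so
    they converge to their supremum. *)
Lemma is_RInt_gen_of_bounded (f : R -> R) (M : R) :
  (forall t, 0 < t -> continuous f t) ->
  (forall t, 0 < t -> 0 < f t) ->
  (forall a b, 0 < a -> a <= b -> RInt f a b <= M) ->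
  exists l, 0 < l /\ is_RInt_gen f (at_right 0) (Rbar_locally p_infty) l.
Proof.
  intros Hc Hpos HM.
  assert (Hex : forall a b, 0 < a -> a <= b -> ex_RInt f a b).
  { intros a b Ha Hab. apply (ex_RInt_continuous (V := R_CompleteNormedModule)).
    intros z [Hz _]. rewrite Rmin_left in Hz by lra. apply Hc; lra. }
  assert (Hnn : forall a b, 0 < a -> a <= b -> 0 <= RInt f a b).
  { intros a b Ha Hab. apply RInt_ge_0; auto. intros t Ht. left; apply Hpos; lra. }
  set (E := fun r => exists a b, 0 < a /\ a <= b /\ r = RInt f a b).
  destruct (completeness E) as [l [Hub Hlub]].
  { exists M. intros r (a & b & Ha & Hab & ->). now apply HM. }
  { exists (RInt f 1 1), 1, 1. repeat split; lra. }
  exists l. split.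
  - apply Rlt_le_trans with (RInt f 1 2).
    + apply RInt_gt_0; [lra | intros t Ht; apply Hpos; lra |].
      intros t Ht; apply Hc; lra.
    + apply Hub. exists 1, 2. repeat split; lra.
  - intros P [eps HP].
    assert (Hnear : exists a0 b0, 0 < a0 /\ a0 <= b0 /\ l - eps < RInt f a0 b0).
    { destruct (Classical_Prop.classic
        (exists a0 b0, 0 < a0 /\ a0 <= b0 /\ l - eps < RInt f a0 b0)) as [H | H]; auto.
      exfalso. assert (l <= l - eps); [| destruct eps; simpl in *; lra].
      apply Hlub. intros r (a & b & Ha & Hab & ->).
      destruct (Rle_lt_dec (RInt f a b) (l - eps)) as [Hr | Hr]; auto.
      exfalso; apply H; eauto. }
    destruct Hnear as (a0 & b0 & Ha0 & Hab0 & Hr).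
    apply Filter_prod with (Q := fun a => 0 < a <= a0) (R := fun b => b0 <= b).
    + exists (mkposreal a0 Ha0). intros y Hy Hy0. split; auto.
      change (Rabs (y - 0) < a0) in Hy. apply Rabs_def2 in Hy. lra.
    + exists b0. intros y Hy; lra.
    + intros a b Ha Hb. exists (RInt f a b). split.
      * apply (RInt_correct (V := R_CompleteNormedModule)). apply Hex; lra.
      * apply HP. change (Rabs (RInt f a b - l) < eps).
        assert (RInt f a b <= l) by (apply Hub; exists a, b; repeat split; lra).
        assert (Hsplit : RInt f a b = RInt f a a0 + (RInt f a0 b0 + RInt f b0 b)).
        { rewrite <- (RInt_Chasles f a a0 b), <- (RInt_Chasles f a0 b0 b);
            try reflexivity; apply Hex; lra. }
        pose proof (Hnn a a0 ltac:(lra) ltac:(lra)).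
        pose proof (Hnn b0 b ltac:(lra) ltac:(lra)).
        apply Rabs_def1; destruct eps; simpl in *; lra.
Qed.

Lemma exp_le_exp (x y : R) : x <= y -> exp x <= exp y.
Proof.
  intros [H | ->]; [left; now apply exp_increasing | apply Rle_refl].
Qed.

Lemma ln_le_tangent (m y : R) : 0 < m -> 0 < y -> ln y <= y / m + ln m - 1.
Proof.
  intros Hm Hy. pose proof (exp_ineq1_le (ln (y / m))) as H.
  rewrite exp_ln in H by (apply Rdiv_lt_0_compat; lra).
  rewrite ln_div in H by lra. lra.
Qed.

(** Logarithmic form of [(1 + t)^p exp (- t) <= C]; it controls the Gamma
    integrand at both ends at once. *)
Lemma Rpower_exp_decay (p t : R) :
  0 < p -> 0 < t -> p * ln (1 + t) - t <= 1 + p * ln p - p.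
Proof.
  intros Hp Ht. pose proof (ln_le_tangent p (1 + t) Hp ltac:(lra)) as H.
  apply Rmult_le_compat_l with (r := p) in H; [| lra].
  replace (p * ((1 + t) / p + ln p - 1)) with (1 + t + p * ln p - p) in H
    by (field; lra). lra.
Qed.

(** The integrand is dominated by the derivative of a constant multiple of
    [(t / (1 + t))^x], an antiderivative that is bounded on all of [(0, oo)]. *)
Lemma ex_RInt_gen_Gamma (x : R) : 0 < x ->
  exists l, 0 < l /\
    is_RInt_gen (fun t => Rpower t (x - 1) * exp (- t))
      (at_right 0) (Rbar_locally p_infty) l.
Proof.
  intros Hx.
  set (C := 1 + (x + 1) * ln (x + 1) - (x + 1)).
  set (H := fun t => exp C / x * exp (x * (ln t - ln (1 + t)))).
  set (H' := fun t => exp C / x * (x * (/ t - / (1 + t)) * exp (x * (ln t - ln (1 + t))))).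
  assert (Hcont : forall t, 0 < t -> continuous (fun t => Rpower t (x - 1) * exp (- t)) t).
  { intros t Ht. apply (ex_derive_continuous (V := R_NormedModule)).
    unfold Rpower. auto_derive. lra. }
  apply is_RInt_gen_of_bounded with (M := exp C / x); auto.
  { intros t Ht. apply Rmult_lt_0_compat; apply exp_pos. }
  intros a b Ha Hab.
  assert (HI : is_RInt H' a b (H b - H a)).
  { apply (is_RInt_derive (V := R_CompleteNormedModule) H H').
    - intros t [Ht _]. rewrite Rmin_left in Ht by lra.
      unfold H, H'. auto_derive; [repeat split; lra | unfold Rminus; field; lra].
    - intros t [Ht _]. rewrite Rmin_left in Ht by lra.
      apply (ex_derive_continuous (V := R_NormedModule)).
      unfold H'. auto_derive. repeat split; lra. }
  assert (HeC : 0 < exp C / x) by (apply Rdiv_lt_0_compat; [apply exp_pos | lra]).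
  assert (Hle1 : H b <= exp C / x).
  { unfold H. rewrite <- (Rmult_1_r (exp C / x)) at 2.
    apply Rmult_le_compat_l; [lra |]. apply Rle_trans with (exp 0); [| rewrite exp_0; lra].
    assert (ln b < ln (1 + b)) by (apply ln_increasing; lra).
    apply exp_le_exp. nra. }
  assert (Hge0 : 0 <= H a).
  { apply Rmult_le_pos; [lra | left; apply exp_pos]. }
  apply Rle_trans with (H b - H a); [| lra].
  rewrite <- (is_RInt_unique _ _ _ _ HI).
  apply RInt_le; auto.
  - apply (ex_RInt_continuous (V := R_CompleteNormedModule)).
    intros z [Hz _]. rewrite Rmin_left in Hz by lra. apply Hcont; lra.
  - now exists (H b - H a).
  - intros t [Ht _]. assert (Ht0 : 0 < t) by lra. unfold H'.
    replace (exp C / x * (x * (/ t - / (1 + t)) * exp (x * (ln t - ln (1 + t)))))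
      with (exp (C + (x - 1) * ln t - (x + 1) * ln (1 + t))).
    + unfold Rpower. rewrite <- exp_plus.
      pose proof (Rpower_exp_decay (x + 1) t ltac:(lra) Ht0) as HD. fold C in HD.
      apply exp_le_exp. lra.
    + replace (C + (x - 1) * ln t - (x + 1) * ln (1 + t))
        with (C + (x * (ln t - ln (1 + t)) + (- ln t + - ln (1 + t)))) by ring.
      rewrite !exp_plus, !exp_Ropp, !exp_ln by lra. field. lra.
Qed.

Lemma Gamma_spec (x : R) : 0 < x ->
  0 < Gamma x /\
  is_RInt_gen (fun t => Rpower t (x - 1) * exp (- t))
    (at_right 0) (Rbar_locally p_infty) (Gamma x).
Proof.
  intros Hx. destruct (ex_RInt_gen_Gamma x Hx) as (l & Hl0 & Hl).
  unfold Gamma.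
  now rewrite (is_RInt_gen_unique (V := R_CompleteNormedModule) _ _ Hl).
Qed.

Lemma Gamma_pos (x : R) : 0 < x -> 0 < Gamma x.
Proof. intros Hx. exact (proj1 (Gamma_spec x Hx)). Qed.

(** Integration by parts: [t^x exp (- t)] is [x t^(x-1) exp (- t)] minus the
    derivative of [t^x exp (- t)], which vanishes at both ends. *)
Lemma Gamma_succ (x : R) : 0 < x -> Gamma (x + 1) = x * Gamma x.
Proof.
  intros Hx.
  set (h := fun t => exp (x * ln t - t)).
  assert (Hder : forall t, 0 < t -> is_derive h t ((x / t - 1) * exp (x * ln t - t))).
  { intros t Ht. unfold h. auto_derive; [lra | unfold Rminus; field; lra]. }
  assert (Hev : filter_prod (at_right 0) (Rbar_locally p_infty)
    (fun ab => 0 < Rmin (fst ab) (snd ab))).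
  { apply Filter_prod with (Q := fun a => 0 < a) (R := fun b => 0 < b).
    - exists (mkposreal 1 Rlt_0_1). auto.
    - exists 0; auto.
    - intros a b Ha Hb; simpl. now apply Rmin_pos. }
  assert (Hparts : is_RInt_gen (Derive h) (at_right 0) (Rbar_locally p_infty) (0 - 0)).
  { apply is_RInt_gen_Derive.
    - revert Hev. apply filter_imp. intros ab Hab t [Ht _].
      eexists; apply Hder; lra.
    - revert Hev. apply filter_imp. intros ab Hab t [Ht _].
      assert (Ht0 : 0 < t) by lra.
      apply (continuous_ext_loc _ (fun t => (x / t - 1) * exp (x * ln t - t))).
      + exists (mkposreal t Ht0). intros y Hy. change (Rabs (y - t) < t) in Hy.
        apply Rabs_def2 in Hy. symmetry; apply is_derive_unique, Hder; lra.
      + apply (ex_derive_continuous (V := R_NormedModule)). auto_derive. lra.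
    - apply (filterlim_comp _ _ _ (fun t => x * ln t - t) exp (at_right 0) (Rbar_locally m_infty)).
      2: exact is_lim_exp_m.
      intros P [M HM]. exists (mkposreal (exp (M / x)) (exp_pos _)).
      intros y Hy Hy0. apply HM. change (Rabs (y - 0) < exp (M / x)) in Hy.
      apply Rabs_def2 in Hy.
      assert (ln y < M / x) as Hl.
      { rewrite <- (ln_exp (M / x)). apply ln_increasing; lra. }
      apply Rmult_lt_compat_l with (r := x) in Hl; [| lra].
      replace (x * (M / x)) with M in Hl by (field; lra). lra.
    - apply (filterlim_comp _ _ _ (fun t => x * ln t - t) exp _ (Rbar_locally m_infty)).
      2: exact is_lim_exp_m.
      set (C := 1 + (x + 1) * ln (x + 1) - (x + 1)).
      intros P [M HM]. exists (exp (C - M)). intros y Hy. apply HM.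
      assert (0 < y) by (pose proof (exp_pos (C - M)); lra).
      pose proof (Rpower_exp_decay (x + 1) y ltac:(lra) ltac:(lra)) as HD. fold C in HD.
      assert (C - M < ln y).
      { rewrite <- (ln_exp (C - M)). apply ln_increasing; [apply exp_pos | lra]. }
      assert (ln y < ln (1 + y)) by (apply ln_increasing; lra).
      nra. }
  pose proof (is_RInt_gen_scal (V := R_NormedModule) _ x _ (proj2 (Gamma_spec x Hx))) as H1.
  pose proof (is_RInt_gen_minus (V := R_NormedModule) _ _ _ _ H1 Hparts) as H2.
  transitivity (minus (scal x (Gamma x)) (0 - 0)).
  2: { unfold minus, scal, plus, opp; simpl. unfold mult; simpl. ring. }
  unfold Gamma at 1.
  apply (is_RInt_gen_unique (V := R_CompleteNormedModule)).
  revert H2. apply is_RInt_gen_ext.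
  revert Hev. apply filter_imp. intros ab Hab t [Ht _].
  assert (Ht0 : 0 < t) by lra.
  rewrite (is_derive_unique _ _ _ (Hder t Ht0)).
  unfold minus, scal, plus, opp; simpl. unfold mult; simpl.
  unfold Rpower.
  replace (x * ln t - t) with ((x - 1) * ln t + (ln t + - t)) by ring.
  replace ((x + 1 - 1) * ln t) with ((x - 1) * ln t + ln t) by ring.
  rewrite !exp_plus, exp_ln by lra. field. lra.
Qed.

(** * The Bessel function as an entire series *)

Fixpoint rising (x : R) (n : nat) : R :=
  match n with
  | O => 1
  | S m => rising x m * (x + INR m)
  end.

Lemma rising_pos (x : R) (n : nat) : 0 < x -> 0 < rising x n.
Proof.
  intros Hx. induction n as [| n IH]; simpl; [lra |].
  pose proof (pos_INR n). apply Rmult_lt_0_compat; lra.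
Qed.

Lemma Gamma_rising (x : R) (n : nat) : 0 < x -> Gamma (x + INR n) = Gamma x * rising x n.
Proof.
  intros Hx. induction n as [| n IH]; simpl rising.
  - simpl. now rewrite Rplus_0_r, Rmult_1_r.
  - rewrite S_INR, <- Rplus_assoc, Gamma_succ, IH; [ring |].
    pose proof (pos_INR n); lra.
Qed.

Definition phi_coef (nu : R) (k : nat) : R := / (INR (fact k) * rising nu k).
Definition phi (nu : R) : R -> R := PSeries (phi_coef nu).
Definition dphi (nu : R) : R -> R := PSeries (PS_derive (phi_coef nu)).
Definition d2phi (nu : R) : R -> R := PSeries (PS_derive (PS_derive (phi_coef nu))).

Lemma phi_coef_pos (nu : R) (k : nat) : 0 < nu -> 0 < phi_coef nu k.
Proof.
  intros Hnu. apply Rinv_0_lt_compat, Rmult_lt_0_compat.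
  - apply INR_fact_lt_0.
  - now apply rising_pos.
Qed.

Lemma phi_coef_succ (nu : R) (k : nat) : 0 < nu ->
  INR (S k) * (nu + INR k) * phi_coef nu (S k) = phi_coef nu k.
Proof.
  intros Hnu. unfold phi_coef. rewrite fact_simpl, mult_INR. simpl rising.
  pose proof (pos_INR k). pose proof (rising_pos nu k Hnu).
  pose proof (INR_fact_lt_0 k). rewrite S_INR. field. repeat split; lra.
Qed.

Lemma CV_radius_phi (nu : R) : 0 < nu -> CV_radius (phi_coef nu) = p_infty.
Proof.
  intros Hnu. apply CV_radius_infinite_DAlembert.
  - intros n. pose proof (phi_coef_pos nu n Hnu); lra.
  - apply is_lim_seq_le_le with (u := fun _ => 0) (w := fun n => / nu * / INR (S n)).
    + intros n. split; [apply Rabs_pos |].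
      pose proof (phi_coef_pos nu n Hnu) as H1. pose proof (phi_coef_pos nu (S n) Hnu) as H2.
      pose proof (phi_coef_succ nu n Hnu) as H3. pose proof (pos_INR n).
      assert (0 < INR (S n)) by (rewrite S_INR; lra).
      rewrite Rabs_right by (apply Rle_ge, Rlt_le, Rdiv_lt_0_compat; lra).
      rewrite <- H3.
      replace (phi_coef nu (S n) / (INR (S n) * (nu + INR n) * phi_coef nu (S n)))
        with (/ (nu + INR n) * / INR (S n)) by (field; repeat split; lra).
      apply Rmult_le_compat_r; [left; now apply Rinv_0_lt_compat |].
      apply Rinv_le_contravar; lra.
    + apply is_lim_seq_const.
    + replace (Finite 0) with (Rbar_mult (/ nu) 0) by (simpl; f_equal; ring).
      apply is_lim_seq_scal_l.
      apply (is_lim_seq_incr_1 (fun n => / INR n)).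
      replace (Finite 0) with (Rbar_inv p_infty) by reflexivity.
      apply is_lim_seq_inv; [apply is_lim_seq_INR | discriminate].
Qed.

Lemma ex_pseries_of_entire (a : nat -> R) (z : R) : CV_radius a = p_infty -> ex_pseries a z.
Proof. intros H. apply CV_radius_inside. rewrite H. exact I. Qed.

Lemma is_derive_phi (nu z : R) : 0 < nu -> is_derive (phi nu) z (dphi nu z).
Proof. intros H. apply is_derive_PSeries. rewrite CV_radius_phi; simpl; auto. Qed.

Lemma is_derive_dphi (nu z : R) : 0 < nu -> is_derive (dphi nu) z (d2phi nu z).
Proof.
  intros H. apply is_derive_PSeries. rewrite CV_radius_derive, CV_radius_phi; simpl; auto.
Qed.

Lemma Derive_phi (nu z : R) : 0 < nu -> Derive (fun x => phi nu x) z = dphi nu z.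
Proof. intros H. now apply is_derive_unique, is_derive_phi. Qed.

Lemma Derive_dphi (nu z : R) : 0 < nu -> Derive (fun x => dphi nu x) z = d2phi nu z.
Proof. intros H. now apply is_derive_unique, is_derive_dphi. Qed.

(** Bessel's equation in the variable [z = t^2 / 4]. *)
Lemma phi_ode (nu z : R) : 0 < nu ->
  z * d2phi nu z + nu * dphi nu z = phi nu z.
Proof.
  intros Hnu. unfold d2phi, dphi, phi.
  assert (HR := CV_radius_phi nu Hnu).
  rewrite <- PSeries_incr_1, <- PSeries_scal, <- PSeries_plus.
  - apply PSeries_ext. intros n.
    (* Coefficientwise, [n (n + 1) + nu (n + 1) = (n + 1) (nu + n)]. *)
    change (PS_incr_1 (PS_derive (PS_derive (phi_coef nu))) n
      + nu * (INR (S n) * phi_coef nu (S n)) = phi_coef nu n).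
    rewrite <- (phi_coef_succ nu n Hnu). destruct n as [| n].
    + change (0 + nu * (INR 1 * phi_coef nu 1) = INR 1 * (nu + 0) * phi_coef nu 1). ring.
    + change (INR (S n) * (INR (S (S n)) * phi_coef nu (S (S n)))
        + nu * (INR (S (S n)) * phi_coef nu (S (S n)))
        = INR (S (S n)) * (nu + INR (S n)) * phi_coef nu (S (S n))). ring.
  - apply ex_pseries_of_entire. now rewrite CV_radius_incr_1, !CV_radius_derive.
  - apply ex_pseries_of_entire. rewrite CV_radius_scal by lra. now rewrite CV_radius_derive.
Qed.

Lemma PSeries_nonneg (a : nat -> R) (z : R) :
  (forall n, 0 <= a n) -> 0 <= z -> CV_radius a = p_infty -> 0 <= PSeries a z.
Proof.
  intros Ha Hz HR.
  assert (H : Series (fun n => 0 * a n) <= PSeries a z).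
  { apply Series_le.
    - intros n. rewrite Rmult_0_l. split; [lra |].
      apply Rmult_le_pos; auto. now apply pow_le.
    - apply ex_pseries_R. now apply ex_pseries_of_entire. }
  rewrite Series_scal_l in H. lra.
Qed.

Lemma PSeries_ge_head (a : nat -> R) (z : R) :
  (forall n, 0 <= a n) -> 0 <= z -> CV_radius a = p_infty -> a 0%nat <= PSeries a z.
Proof.
  intros Ha Hz HR. rewrite PSeries_decr_1 by now apply ex_pseries_of_entire.
  assert (0 <= z * PSeries (PS_decr_1 a) z); [| lra].
  apply Rmult_le_pos; auto. apply PSeries_nonneg; auto.
  - intros n. apply Ha.
  - now rewrite CV_radius_decr_1.
Qed.

Lemma phi_ge_1 (nu z : R) : 0 < nu -> 0 <= z -> 1 <= phi nu z.
Proof.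
  intros Hnu Hz. replace 1 with (phi_coef nu 0) by (unfold phi_coef; simpl; field).
  apply PSeries_ge_head; auto.
  - intros n. left. now apply phi_coef_pos.
  - now apply CV_radius_phi.
Qed.

Lemma dphi_nonneg (nu z : R) : 0 < nu -> 0 <= z -> 0 <= dphi nu z.
Proof.
  intros Hnu Hz. apply PSeries_nonneg; auto.
  - intros n. apply Rmult_le_pos; [apply pos_INR | left; now apply phi_coef_pos].
  - now rewrite CV_radius_derive, CV_radius_phi.
Qed.

Lemma d2phi_nonneg (nu z : R) : 0 < nu -> 0 <= z -> 0 <= d2phi nu z.
Proof.
  intros Hnu Hz. apply PSeries_nonneg; auto.
  - intros n. repeat (apply Rmult_le_pos; [apply pos_INR |]). left; now apply phi_coef_pos.
  - now rewrite !CV_radius_derive, CV_radius_phi.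
Qed.

Lemma Rpower_even_split (x p : R) (k : nat) : 0 < x ->
  Rpower x (2 * INR k + p) = Rpower x p * (x ^ 2) ^ k.
Proof.
  intros Hx. rewrite Rpower_plus, Rmult_comm. f_equal.
  replace (2 * INR k) with (INR (2 * k)) by (rewrite mult_INR; reflexivity).
  rewrite Rpower_pow by auto. apply pow_mult.
Qed.

Lemma besselI_pred (nu t : R) : 0 < nu -> 0 < t ->
  besselI (nu - 1) t = Rpower (t / 2) (nu - 1) / Gamma nu * phi nu (t ^ 2 / 4).
Proof.
  intros Hnu Ht. unfold besselI, phi, PSeries. rewrite <- Series_scal_l.
  apply Series_ext. intros k.
  replace (nu - 1 + INR k + 1) with (nu + INR k) by ring.
  rewrite Gamma_rising, Rpower_even_split by lra.
  replace ((t / 2) ^ 2) with (t ^ 2 / 4) by field.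
  pose proof (Gamma_pos nu Hnu). pose proof (rising_pos nu k Hnu).
  pose proof (INR_fact_lt_0 k). unfold phi_coef. field. repeat split; lra.
Qed.

Lemma besselI_dphi (nu t : R) : 0 < nu -> 0 < t ->
  besselI nu t = Rpower (t / 2) nu / Gamma nu * dphi nu (t ^ 2 / 4).
Proof.
  intros Hnu Ht. unfold besselI, dphi, PSeries. rewrite <- Series_scal_l.
  apply Series_ext. intros k.
  replace (nu + INR k + 1) with (nu + INR (S k)) by (rewrite S_INR; ring).
  rewrite Gamma_rising, Rpower_even_split by lra.
  replace ((t / 2) ^ 2) with (t ^ 2 / 4) by field.
  pose proof (Gamma_pos nu Hnu). pose proof (rising_pos nu (S k) Hnu).
  pose proof (INR_fact_lt_0 k). pose proof (pos_INR k).
  unfold PS_derive, phi_coef. rewrite fact_simpl, mult_INR, S_INR.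
  field. repeat split; lra.
Qed.

(** * Log-concavity through second derivatives *)

Lemma is_derive_ge_of_slope (f : R -> R) (x l m : R) :
  is_derive f x l -> (forall h, 0 < h < 1 -> m * h <= f (x + h) - f x) -> m <= l.
Proof.
  intros Hf Hm. destruct (Rle_lt_dec m l) as [H | H]; auto. exfalso.
  apply is_derive_Reals in Hf. destruct (Hf (m - l) ltac:(lra)) as [d Hd].
  set (h := Rmin (d / 2) (1 / 2)).
  assert (Hh : 0 < h < d /\ h < 1).
  { unfold h. destruct d as [d Hd0]; simpl.
    pose proof (Rmin_l (d / 2) (1 / 2)). pose proof (Rmin_r (d / 2) (1 / 2)).
    pose proof (Rmin_pos (d / 2) (1 / 2)). lra. }
  specialize (Hd h ltac:(lra)). rewrite Rabs_right in Hd by lra.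
  specialize (Hd ltac:(lra)). apply Rabs_def2 in Hd.
  specialize (Hm h ltac:(lra)).
  assert (m <= (f (x + h) - f x) / h); [| lra].
  apply Rmult_le_reg_r with h; [lra |].
  replace ((f (x + h) - f x) / h * h) with (f (x + h) - f x) by (field; lra). lra.
Qed.

Lemma is_derive_le_of_nonpos (f f' : R -> R) (x y : R) :
  x <= y -> (forall t, x <= t <= y -> is_derive f t (f' t)) ->
  (forall t, x <= t <= y -> f' t <= 0) -> f y <= f x.
Proof.
  intros Hxy Hd Hs.
  destruct (MVT_gen f x y f') as (c & Hc & He).
  - rewrite Rmin_left, Rmax_right by lra. intros t Ht. apply Hd; lra.
  - rewrite Rmin_left, Rmax_right by lra. intros t Ht.
    apply derivable_continuous_pt. exists (f' t). apply is_derive_Reals, Hd; lra.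
  - rewrite Rmin_left, Rmax_right in Hc by lra.
    specialize (Hs c Hc). nra.
Qed.

Definition concave_pos (g : R -> R) : Prop :=
  forall x y lambda, 0 < x -> 0 < y -> 0 < lambda < 1 ->
    lambda * g x + (1 - lambda) * g y <= g (lambda * x + (1 - lambda) * y).

(** Both directions go through the tangent inequality
    [g y - g x <= g' x * (y - x)]. *)
Lemma concave_pos_iff (g g' g'' : R -> R) :
  (forall t, 0 < t -> is_derive g t (g' t)) ->
  (forall t, 0 < t -> is_derive g' t (g'' t)) ->
  (concave_pos g <-> forall t, 0 < t -> g'' t <= 0).
Proof.
  intros Hg Hg'. split.
  - intros Hc.
    assert (Htan : forall x y, 0 < x -> 0 < y -> g y - g x <= g' x * (y - x)).
    { intros x y Hx Hy.
      apply is_derive_ge_of_slope with (f := fun h => g (x + h * (y - x))) (x := 0).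
      - replace (g' x * (y - x)) with (scal (y - x) (g' x))
          by (unfold scal; simpl; unfold mult; simpl; ring).
        apply (is_derive_comp g (fun h => x + h * (y - x))).
        + replace (x + 0 * (y - x)) with x by ring. now apply Hg.
        + auto_derive; auto. ring.
      - intros h Hh. specialize (Hc y x h Hy Hx Hh).
        replace (x + (0 + h) * (y - x)) with (h * y + (1 - h) * x) by ring.
        replace (x + 0 * (y - x)) with x by ring. lra. }
    intros t Ht.
    assert (0 <= - g'' t); [| lra].
    apply is_derive_ge_of_slope with (f := fun s => - g' s) (x := t).
    + apply (is_derive_opp (V := R_NormedModule)). now apply Hg'.
    + intros h Hh. pose proof (Htan t (t + h) Ht ltac:(lra)).
      pose proof (Htan (t + h) t ltac:(lra) Ht). nra.
  - intros Hs.
    assert (Hdec : forall x y, 0 < x -> x <= y -> g' y <= g' x).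
    { intros x y Hx Hxy. apply is_derive_le_of_nonpos with g''; auto.
      - intros t Ht; apply Hg'; lra.
      - intros t Ht; apply Hs; lra. }
    assert (Htan : forall w x, 0 < w -> 0 < x -> g x - g w <= g' w * (x - w)).
    { intros w x Hw Hx.
      assert (Hmin : 0 < Rmin w x) by now apply Rmin_pos.
      destruct (MVT_gen g w x g') as (c & Hc & He).
      - intros t Ht. apply Hg; lra.
      - intros t Ht. apply derivable_continuous_pt. exists (g' t).
        apply is_derive_Reals, Hg; lra.
      - rewrite He. destruct (Rle_lt_dec w x) as [H | H].
        + rewrite Rmin_left, Rmax_right in Hc by lra.
          pose proof (Hdec w c Hw ltac:(lra)). nra.
        + rewrite Rmin_right, Rmax_left in Hc by lra.
          pose proof (Hdec c w ltac:(lra) ltac:(lra)). nra. }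
    intros x y l Hx Hy Hl. set (w := l * x + (1 - l) * y).
    assert (Hw : 0 < w) by (unfold w; nra).
    pose proof (Htan w x Hw Hx) as H1. pose proof (Htan w y Hw Hy) as H2.
    apply Rmult_le_compat_l with (r := l) in H1; [| lra].
    apply Rmult_le_compat_l with (r := 1 - l) in H2; [| lra].
    assert (l * (g' w * (x - w)) + (1 - l) * (g' w * (y - w)) = 0) by (unfold w; ring).
    lra.
Qed.

Lemma log_concave_on_exp_iff (f g : R -> R) (C : R) : 0 < C ->
  (forall t, 0 < t -> f t = C * exp (g t)) ->
  (log_concave_on (fun t => 0 < t) f <-> concave_pos g).
Proof.
  intros HC Hf.
  assert (Hpow : forall x l, 0 < x -> nonneg_power (f x) l = exp (l * (ln C + g x))).
  { intros x l Hx. rewrite (Hf x Hx).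
    assert (0 < C * exp (g x)) by (apply Rmult_lt_0_compat; auto; apply exp_pos).
    unfold nonneg_power. destruct (Rlt_dec 0 (C * exp (g x))); [| lra].
    unfold Rpower. rewrite ln_mult, ln_exp by (auto; apply exp_pos). reflexivity. }
  assert (Hexp : forall x, 0 < x -> f x = exp (ln C + g x)).
  { intros x Hx. rewrite Hf, exp_plus, exp_ln; auto. }
  assert (Hw : forall x y l, 0 < x -> 0 < y -> 0 < l < 1 -> 0 < l * x + (1 - l) * y).
  { intros; nra. }
  split.
  - intros [_ H] x y l Hx Hy Hl. specialize (H x y l Hx Hy Hl).
    rewrite !Hpow, Hexp, <- exp_plus in H by auto.
    destruct (Rle_lt_dec (l * g x + (1 - l) * g y) (g (l * x + (1 - l) * y))) as [Hr | Hr]; auto.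
    exfalso. apply (Rlt_irrefl (exp (ln C + g (l * x + (1 - l) * y)))).
    eapply Rlt_le_trans; [| exact H]. apply exp_increasing. lra.
  - intros H. split.
    + intros x Hx. rewrite Hexp by auto. left; apply exp_pos.
    + intros x y l Hx Hy Hl. specialize (H x y l Hx Hy Hl).
      rewrite !Hpow, Hexp, <- exp_plus by auto. apply exp_le_exp. lra.
Qed.

Definition log_marcum (nu a t : R) : R :=
  (2 * nu - 1) * ln t - t ^ 2 / 2 + ln (phi nu ((a * t) ^ 2 / 4)).

Lemma phi_0 (nu : R) : phi nu 0 = 1.
Proof. unfold phi. rewrite PSeries_0. unfold phi_coef; simpl. field. Qed.

Lemma marcum_integrand_exp (nu a t : R) : 0 < nu -> 0 <= a -> 0 < t ->
  marcum_integrand nu a t =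
    exp (- (a ^ 2 / 2)) / (Rpower 2 (nu - 1) * Gamma nu) * exp (log_marcum nu a t).
Proof.
  intros Hnu Ha Ht. pose proof (Gamma_pos nu Hnu) as HG.
  pose proof (exp_pos ((nu - 1) * ln 2)) as H2.
  assert (Hphi : 0 < phi nu ((a * t) ^ 2 / 4)).
  { pose proof (phi_ge_1 nu ((a * t) ^ 2 / 4) Hnu). pose proof (pow2_ge_0 (a * t)). lra. }
  unfold log_marcum.
  replace ((2 * nu - 1) * ln t - t ^ 2 / 2 + ln (phi nu ((a * t) ^ 2 / 4)))
    with ((2 * nu - 1) * ln t + - (t ^ 2 / 2) + ln (phi nu ((a * t) ^ 2 / 4))) by ring.
  rewrite !exp_plus, exp_ln by auto.
  unfold marcum_integrand. destruct (Req_EM_T a 0) as [-> | Hn].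
  - replace ((0 * t) ^ 2 / 4) with 0 by field. rewrite phi_0.
    replace (- (0 ^ 2 / 2)) with 0 by field. rewrite exp_0.
    unfold Rpower. field. lra.
  - rewrite besselI_pred; [| auto | apply Rmult_lt_0_compat; lra].
    replace (- ((t ^ 2 + a ^ 2) / 2)) with (- (a ^ 2 / 2) + - (t ^ 2 / 2)) by field.
    unfold Rpower.
    replace (ln (a * t / 2)) with (ln a + ln t + - ln 2).
    2: { unfold Rdiv. rewrite ln_mult, ln_mult, ln_Rinv; try lra; nra. }
    replace ((2 * nu - 1) * ln t) with (nu * ln t + (nu - 1) * ln t) by ring.
    replace ((nu - 1) * (ln a + ln t + - ln 2))
      with ((nu - 1) * ln a + (nu - 1) * ln t + - ((nu - 1) * ln 2)) by ring.
    rewrite !exp_plus, (exp_Ropp ((nu - 1) * ln 2)). field.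
    pose proof (exp_pos ((nu - 1) * ln a)). repeat split; lra.
Qed.

(** * Log-concavity as positivity of the defect *)

Definition rho (nu z : R) : R := 2 * z * dphi nu z / phi nu z.

(** [- (defect nu z)] is [t^2] times the second derivative of
    [(2 nu - 1) ln t + ln (phi nu z)], where [z] is proportional to [t^2]. *)
Definition defect (nu z : R) : R :=
  rho nu z ^ 2 + (2 * nu - 1) * (rho nu z + 1) - 4 * z.

(** The Riccati equation of [rho]. The factor [2 z] on the left keeps the
    statement valid at [z = 0]. *)
Lemma is_derive_rho (nu z : R) : 0 < nu -> 0 <= z ->
  exists d, is_derive (rho nu) z d /\
    2 * z * d = 4 * z - rho nu z ^ 2 - 2 * (nu - 1) * rho nu z.
Proof.
  intros Hnu Hz. pose proof (phi_ge_1 nu z Hnu Hz) as Hp.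
  exists (2 * (dphi nu z + z * d2phi nu z) / phi nu z
          - 2 * z * dphi nu z ^ 2 / phi nu z ^ 2).
  split.
  - unfold rho. auto_derive.
    + repeat split; auto; [eexists; now apply is_derive_dphi
        | eexists; now apply is_derive_phi | lra].
    + rewrite Derive_dphi by auto.
      rewrite Derive_phi by auto.
      field. lra.
  - unfold rho. replace (z * d2phi nu z) with (phi nu z - nu * dphi nu z)
      by (rewrite <- (phi_ode nu z Hnu) at 1; ring).
    field. lra.
Qed.

Lemma is_derive_log_marcum (nu a t : R) : 0 < nu -> 0 < t ->
  is_derive (log_marcum nu a) t ((2 * nu - 1 + rho nu ((a * t) ^ 2 / 4)) / t - t).
Proof.
  intros Hnu Ht.
  assert (Hz : 0 <= (a * t) ^ 2 / 4) by (pose proof (pow2_ge_0 (a * t)); lra).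
  pose proof (phi_ge_1 nu _ Hnu Hz) as Hp.
  unfold log_marcum.
  auto_derive; replace (a * t * (a * t * 1) * / 4) with ((a * t) ^ 2 / 4) by field.
  - repeat split; auto; [eexists; now apply is_derive_phi | lra].
  - rewrite Derive_phi by auto.
    unfold rho. field. lra.
Qed.

Lemma is_derive2_log_marcum (nu a t : R) : 0 < nu -> 0 < t ->
  is_derive (fun t => (2 * nu - 1 + rho nu ((a * t) ^ 2 / 4)) / t - t) t
    (- (defect nu ((a * t) ^ 2 / 4) / t ^ 2) - 1).
Proof.
  intros Hnu Ht.
  assert (Hz : 0 <= (a * t) ^ 2 / 4) by (pose proof (pow2_ge_0 (a * t)); lra).
  destruct (is_derive_rho nu _ Hnu Hz) as (d & Hd & He).
  assert (HD : Derive (fun x : R => rho nu x) ((a * t) ^ 2 / 4) = d)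
    by now apply is_derive_unique.
  auto_derive; replace (a * t * (a * t * 1) * / 4) with ((a * t) ^ 2 / 4) by field.
  - repeat split; try lra. now exists d.
  - rewrite HD. unfold defect.
    set (z := (a * t) ^ 2 / 4) in *.
    transitivity ((2 * z * d - (2 * nu - 1) - rho nu z) / t ^ 2 - 1).
    + unfold z. field. lra.
    + rewrite He. field. lra.
Qed.

(** For fixed [z], the scaling [a = 2 sqrt z / t] lets [t] be arbitrarily
    small, so a negative defect outweighs the [-1] coming from [- t^2 / 2]. *)
Lemma log_concave_iff_defect (nu : R) : 0 < nu ->
  ((forall a, 0 <= a ->
      log_concave_on (fun t => 0 < t) (fun t => marcum_integrand nu a t))
   <-> forall z, 0 <= z -> 0 <= defect nu z).
Proof.
  intros Hnu.
  assert (Heq : forall a, 0 <= a ->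
    (log_concave_on (fun t => 0 < t) (fun t => marcum_integrand nu a t)
     <-> forall t, 0 < t -> - (defect nu ((a * t) ^ 2 / 4) / t ^ 2) - 1 <= 0)).
  { intros a Ha.
    rewrite (log_concave_on_exp_iff _ (log_marcum nu a)
      (exp (- (a ^ 2 / 2)) / (Rpower 2 (nu - 1) * Gamma nu))).
    - apply (concave_pos_iff _ (fun t => (2 * nu - 1 + rho nu ((a * t) ^ 2 / 4)) / t - t)
        (fun t => - (defect nu ((a * t) ^ 2 / 4) / t ^ 2) - 1)).
      + intros t Ht. now apply is_derive_log_marcum.
      + intros t Ht. now apply is_derive2_log_marcum.
    - apply Rdiv_lt_0_compat; [apply exp_pos |].
      apply Rmult_lt_0_compat; [apply exp_pos | now apply Gamma_pos].
    - intros t Ht. now apply marcum_integrand_exp. }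
  split.
  - intros H z Hz. destruct (Rle_lt_dec 0 (defect nu z)) as [Hd | Hd]; auto. exfalso.
    (* With this [t], the second derivative at [t] equals [1]. *)
    set (t := sqrt (- defect nu z / 2)).
    assert (Ht : 0 < t) by (apply sqrt_lt_R0; lra).
    assert (Ht2 : t ^ 2 = - defect nu z / 2) by (apply pow2_sqrt; lra).
    assert (Ha : 0 <= 2 * sqrt z / t).
    { apply Rmult_le_pos; [pose proof (sqrt_pos z); lra | left; now apply Rinv_0_lt_compat]. }
    pose proof (proj1 (Heq _ Ha) (H _ Ha) t Ht) as Hneg.
    replace ((2 * sqrt z / t * t) ^ 2 / 4) with z in Hneg.
    2: { replace (2 * sqrt z / t * t) with (2 * sqrt z) by (field; lra).
         rewrite Rpow_mult_distr, pow2_sqrt by auto. field. }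
    rewrite Ht2 in Hneg.
    replace (- (defect nu z / (- defect nu z / 2))) with 2 in Hneg by (field; lra). lra.
  - intros H a Ha. apply (Heq a Ha). intros t Ht.
    assert (Hz : 0 <= (a * t) ^ 2 / 4) by (pose proof (pow2_ge_0 (a * t)); lra).
    specialize (H _ Hz).
    assert (0 <= defect nu ((a * t) ^ 2 / 4) / t ^ 2); [| lra].
    apply Rmult_le_pos; auto. left. apply Rinv_0_lt_compat, pow_lt; auto.
Qed.

(** * The sign of the defect *)

(** [phi nu z] times [rho nu z - (3 - 2 nu)]. As a power series, its coefficients
    for [1/2 < nu < 3/2] are negative at degree 0 and positive afterwards. *)
Definition crossing (nu z : R) : R := 2 * z * dphi nu z - (3 - 2 * nu) * phi nu z.

Lemma is_derive_crossing (nu z : R) : 0 < nu ->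
  is_derive (crossing nu) z (2 * phi nu z - dphi nu z).
Proof.
  intros Hnu. unfold crossing. auto_derive.
  - repeat split; eexists; [now apply is_derive_dphi | now apply is_derive_phi].
  - rewrite Derive_dphi by auto.
    rewrite Derive_phi by auto.
    rewrite <- (phi_ode nu z Hnu). ring.
Qed.

(** The differential equation with [z * phi'' >= 0]. *)
Lemma dphi_le (nu z : R) : 0 < nu -> 0 <= z -> nu * dphi nu z <= phi nu z.
Proof.
  intros Hnu Hz. rewrite <- (phi_ode nu z Hnu).
  pose proof (Rmult_le_pos _ _ Hz (d2phi_nonneg nu z Hnu Hz)). lra.
Qed.

(** The derivative [2 phi - phi'] is nonnegative by [dphi_le], since
    [1 / nu <= 2]. *)
Lemma crossing_incr (nu x y : R) : 1 / 2 <= nu -> 0 <= x -> x <= y ->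
  crossing nu x <= crossing nu y.
Proof.
  intros Hnu Hx Hxy.
  assert (- crossing nu y <= - crossing nu x); [| lra].
  apply (is_derive_le_of_nonpos (fun z => - crossing nu z)
    (fun z => - (2 * phi nu z - dphi nu z))); auto; intros t Ht.
  - apply (is_derive_opp (V := R_NormedModule)). apply is_derive_crossing; lra.
  - pose proof (dphi_le nu t ltac:(lra) ltac:(lra)).
    pose proof (dphi_nonneg nu t ltac:(lra) ltac:(lra)). nra.
Qed.

(** [z^(nu - 3/2) phi^2] times the defect. The weight is the integrating
    factor of the linear equation that the defect satisfies by virtue of the Riccati
    equation. *)
Definition weighted_defect (nu z : R) : R :=
  exp ((nu - 3 / 2) * ln z) *
  (4 * z ^ 2 * dphi nu z ^ 2 + 2 * (2 * nu - 1) * z * dphi nu z * phi nu z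
   + (2 * nu - 1 - 4 * z) * phi nu z ^ 2).

Lemma weighted_defect_eq (nu z : R) : 0 < nu -> 0 < z ->
  weighted_defect nu z = exp ((nu - 3 / 2) * ln z) * phi nu z ^ 2 * defect nu z.
Proof.
  intros Hnu Hz. pose proof (phi_ge_1 nu z Hnu ltac:(lra)).
  unfold weighted_defect, defect, rho. field. lra.
Qed.

Lemma defect_nonneg_of_weighted (nu z : R) : 0 < nu -> 0 < z ->
  0 <= weighted_defect nu z -> 0 <= defect nu z.
Proof.
  intros Hnu Hz. rewrite weighted_defect_eq by auto. intros H.
  pose proof (phi_ge_1 nu z Hnu ltac:(lra)).
  pose proof (exp_pos ((nu - 3 / 2) * ln z)).
  apply Rmult_le_reg_l with (exp ((nu - 3 / 2) * ln z) * phi nu z ^ 2); [| lra].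
  apply Rmult_lt_0_compat; auto. apply pow_lt. lra.
Qed.

Lemma is_derive_weighted_defect (nu z : R) : 0 < nu -> 0 < z ->
  is_derive (weighted_defect nu) z
    (exp ((nu - 3 / 2) * ln z) * phi nu z * (2 * nu - 1) * crossing nu z / (2 * z)).
Proof.
  intros Hnu Hz. unfold weighted_defect. auto_derive.
  - repeat split; auto; lazymatch goal with
      | |- ex_derive (fun x => dphi nu x) z => exists (d2phi nu z); now apply is_derive_dphi
      | |- ex_derive (fun x => phi nu x) z => exists (dphi nu z); now apply is_derive_phi
      end.
  - rewrite Derive_dphi by auto.
    rewrite Derive_phi by auto.
    replace (d2phi nu z) with ((phi nu z - nu * dphi nu z) / z)
      by (rewrite <- (phi_ode nu z Hnu) at 1; field; lra).
    unfold crossing.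
    replace (nu + - (3 * / 2)) with (nu - 3 / 2) by field.
    field. lra.
Qed.

Lemma weighted_defect_incr (nu x y : R) : 1 / 2 <= nu -> 0 < x -> x <= y ->
  0 <= crossing nu x -> weighted_defect nu x <= weighted_defect nu y.
Proof.
  intros Hnu Hx Hxy Hc.
  assert (- weighted_defect nu y <= - weighted_defect nu x); [| lra].
  apply (is_derive_le_of_nonpos (fun z => - weighted_defect nu z)
    (fun z => - (exp ((nu - 3 / 2) * ln z) * phi nu z * (2 * nu - 1) * crossing nu z / (2 * z))));
    auto; intros t Ht.
  - apply (is_derive_opp (V := R_NormedModule)). apply is_derive_weighted_defect; lra.
  - pose proof (crossing_incr nu x t Hnu ltac:(lra) ltac:(lra)).
    pose proof (phi_ge_1 nu t ltac:(lra) ltac:(lra)).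
    pose proof (exp_pos ((nu - 3 / 2) * ln t)).
    assert (0 <= exp ((nu - 3 / 2) * ln t) * phi nu t * (2 * nu - 1) * crossing nu t / (2 * t));
      [| lra].
    repeat apply Rmult_le_pos; try lra. left; apply Rinv_0_lt_compat; lra.
Qed.

Lemma weighted_defect_decr (nu x y : R) : 1 / 2 <= nu -> 0 < x -> x <= y ->
  crossing nu y <= 0 -> weighted_defect nu y <= weighted_defect nu x.
Proof.
  intros Hnu Hx Hxy Hc.
  apply (is_derive_le_of_nonpos (weighted_defect nu)
    (fun z => exp ((nu - 3 / 2) * ln z) * phi nu z * (2 * nu - 1) * crossing nu z / (2 * z)));
    auto; intros t Ht.
  - apply is_derive_weighted_defect; lra.
  - pose proof (crossing_incr nu t y Hnu ltac:(lra) ltac:(lra)).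
    pose proof (phi_ge_1 nu t ltac:(lra) ltac:(lra)).
    pose proof (exp_pos ((nu - 3 / 2) * ln t)).
    assert (0 <= exp ((nu - 3 / 2) * ln t) * phi nu t * (2 * nu - 1) * (- crossing nu t) / (2 * t));
      [| unfold Rdiv in *; lra].
    repeat apply Rmult_le_pos; try lra. left; apply Rinv_0_lt_compat; lra.
Qed.

Lemma defect_0 (nu : R) : defect nu 0 = 2 * nu - 1.
Proof. unfold defect, rho. rewrite phi_0. field. Qed.

(** The weighted defect is nondecreasing, and it is nonnegative at
    arguments below [1/4], where [2 nu - 1 - 4 z >= 0]. *)
Lemma defect_nonneg_of_ge (nu z : R) : 3 / 2 <= nu -> 0 <= z -> 0 <= defect nu z.
Proof.
  intros Hnu [Hz | <-]; [| rewrite defect_0; lra].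
  apply defect_nonneg_of_weighted; try lra.
  set (w := Rmin z (1 / 4)).
  assert (Hw : 0 < w) by (apply Rmin_pos; lra).
  assert (Hwz : w <= z) by apply Rmin_l.
  assert (Hw4 : w <= 1 / 4) by apply Rmin_r.
  pose proof (phi_ge_1 nu w ltac:(lra) ltac:(lra)).
  pose proof (dphi_nonneg nu w ltac:(lra) ltac:(lra)).
  apply Rle_trans with (weighted_defect nu w).
  - unfold weighted_defect. apply Rmult_le_pos; [left; apply exp_pos |].
    repeat apply Rplus_le_le_0_compat; repeat apply Rmult_le_pos; try apply pow2_ge_0; lra.
  - apply weighted_defect_incr; try lra. unfold crossing.
    assert (0 <= 2 * w * dphi nu w) by (repeat apply Rmult_le_pos; lra).
    nra.
Qed.

(** With [2 nu - 1 <= 0] the defect is at most [rho^2 - 4 z], and [rho] is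
    [O(z)] by [dphi_le]. *)
Lemma defect_neg_of_le (nu : R) : 0 < nu <= 1 / 2 -> exists z, 0 <= z /\ defect nu z < 0.
Proof.
  intros [Hnu Hle]. assert (Hz : 0 < nu ^ 2 / 2) by (pose proof (pow_lt nu 2 Hnu); lra).
  (* Here [rho <= 2 z / nu], hence [rho^2 <= 2 z] at [z = nu^2 / 2]. *)
  exists (nu ^ 2 / 2). split; [lra |].
  set (z := nu ^ 2 / 2) in *.
  pose proof (phi_ge_1 nu z Hnu ltac:(lra)) as Hp.
  pose proof (dphi_nonneg nu z Hnu ltac:(lra)) as Hd.
  pose proof (dphi_le nu z Hnu ltac:(lra)) as Hdp.
  assert (Hr0 : 0 <= rho nu z).
  { unfold rho. repeat apply Rmult_le_pos; try lra. left; apply Rinv_0_lt_compat; lra. }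
  assert (Hr : rho nu z <= nu).
  { unfold rho. apply Rmult_le_reg_r with (phi nu z); [lra |].
    replace (2 * z) with (nu * nu) by (unfold z; field).
    replace (nu * nu * dphi nu z / phi nu z * phi nu z) with (nu * (nu * dphi nu z))
      by (field; lra).
    apply Rmult_le_compat_l; lra. }
  assert (rho nu z ^ 2 < 4 * z).
  { replace (4 * z) with (2 * nu ^ 2) by (unfold z; field). nra. }
  unfold defect. nra.
Qed.

(** At [s = (5 - 2 nu) / 4] the defect is a quadratic in [rho] that
    increases for [rho >= 0] and vanishes at [rho = 3 - 2 nu]; this gives the direct
    implication. Conversely, the weighted defect is minimal at a zero [w <= s] of the
    crossing function, where the defect is [4 (s - w)]. *)
Lemma defect_nonneg_iff_crossing (nu : R) : 1 / 2 < nu < 3 / 2 ->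
  ((forall z, 0 <= z -> 0 <= defect nu z) <-> 0 <= crossing nu ((5 - 2 * nu) / 4)).
Proof.
  intros Hnu. split.
  - intros H. set (s := (5 - 2 * nu) / 4).
    assert (Hs : 0 < s) by (unfold s; lra). specialize (H s ltac:(lra)).
    pose proof (phi_ge_1 nu s ltac:(lra) ltac:(lra)) as Hp.
    pose proof (dphi_nonneg nu s ltac:(lra) ltac:(lra)) as Hd.
    assert (Hr0 : 0 <= rho nu s).
    { unfold rho. repeat apply Rmult_le_pos; try lra. left; apply Rinv_0_lt_compat; lra. }
    assert (Hr : crossing nu s = (rho nu s - (3 - 2 * nu)) * phi nu s).
    { unfold crossing, rho. field. lra. }
    rewrite Hr. apply Rmult_le_pos; [| lra].
    unfold defect in H. unfold s in H at 3.
    destruct (Rle_lt_dec (3 - 2 * nu) (rho nu s)) as [Hc | Hc]; [lra |]. exfalso. nra.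
  - intros Hc z0 Hz0.
    (* The minimum point of the weighted defect. *)
    destruct (IVT_gen (crossing nu) 0 ((5 - 2 * nu) / 4) 0) as (w & Hw & Hw0).
    + intros t. apply derivable_continuous_pt. eexists. apply is_derive_Reals.
      apply is_derive_crossing; lra.
    + assert (crossing nu 0 <= 0) by (unfold crossing; rewrite phi_0; lra).
      rewrite Rmin_left, Rmax_right; lra.
    + rewrite Rmin_left, Rmax_right in Hw by lra.
      assert (Hwpos : 0 < w).
      { destruct (proj1 Hw) as [Hp | <-]; auto. exfalso.
        unfold crossing in Hw0. rewrite phi_0 in Hw0. lra. }
      pose proof (phi_ge_1 nu w ltac:(lra) ltac:(lra)) as Hp.
      assert (Hrho : rho nu w = 3 - 2 * nu).
      { unfold crossing in Hw0. unfold rho.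
        replace (2 * w * dphi nu w) with ((3 - 2 * nu) * phi nu w) by lra. field. lra. }
      assert (HDw : 0 <= weighted_defect nu w).
      { rewrite weighted_defect_eq by lra. apply Rmult_le_pos.
        - apply Rmult_le_pos; [left; apply exp_pos | apply pow2_ge_0].
        - unfold defect. rewrite Hrho. nra. }
      destruct Hz0 as [Hz0 | <-]; [| rewrite defect_0; lra].
      apply defect_nonneg_of_weighted; try lra.
      apply Rle_trans with (1 := HDw).
      destruct (Rle_lt_dec w z0).
      * apply weighted_defect_incr; lra.
      * apply weighted_defect_decr; lra.
Qed.

(** The quotient [I_nu / I_{nu-1}] at [t] is [(t / 2) phi' / phi] at
    [t^2 / 4]. *)
Lemma bessel_equation_iff (nu : R) : 1 / 2 < nu < 3 / 2 ->
  (besselI nu (sqrt (5 - 2 * nu)) / besselI (nu - 1) (sqrt (5 - 2 * nu))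
     = (3 - 2 * nu) / sqrt (5 - 2 * nu)
   <-> crossing nu ((5 - 2 * nu) / 4) = 0).
Proof.
  intros Hnu. set (s := sqrt (5 - 2 * nu)).
  assert (Hs : 0 < s) by (apply sqrt_lt_R0; lra).
  assert (Hs2 : s ^ 2 = 5 - 2 * nu) by (apply pow2_sqrt; lra).
  rewrite besselI_pred, besselI_dphi by lra. rewrite <- Hs2.
  pose proof (phi_ge_1 nu (s ^ 2 / 4) ltac:(lra) ltac:(lra)) as Hp.
  pose proof (Gamma_pos nu ltac:(lra)) as HG.
  replace (Rpower (s / 2) nu) with (Rpower (s / 2) (nu - 1) * (s / 2)).
  2: { rewrite <- (Rpower_1 (s / 2)) at 2 by lra. rewrite <- Rpower_plus. f_equal; ring. }
  pose proof (exp_pos ((nu - 1) * ln (s / 2))) as HP. fold (Rpower (s / 2) (nu - 1)) in HP.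
  set (p := Rpower (s / 2) (nu - 1)) in *.
  replace (p * (s / 2) / Gamma nu * dphi nu (s ^ 2 / 4) / (p / Gamma nu * phi nu (s ^ 2 / 4)))
    with ((3 - 2 * nu) / s + crossing nu (s ^ 2 / 4) / (s * phi nu (s ^ 2 / 4)))
    by (unfold crossing; field; repeat split; lra).
  split; intros H.
  - assert (H' : crossing nu (s ^ 2 / 4) / (s * phi nu (s ^ 2 / 4)) = 0) by lra.
    replace (crossing nu (s ^ 2 / 4))
      with (crossing nu (s ^ 2 / 4) / (s * phi nu (s ^ 2 / 4)) * (s * phi nu (s ^ 2 / 4)))
      by (field; split; lra).
    rewrite H'. ring.
  - rewrite H. unfold Rdiv. ring.
Qed.

(** * The critical equation as a numerical series *)

(** Comparison with a geometric series. *)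
Lemma Series_le_geometric (u : nat -> R) (q : R) :
  (forall n, 0 <= u n) -> (forall n, u (S n) <= q * u n) -> 0 <= q < 1 ->
  ex_series u /\ Series u <= u 0%nat / (1 - q).
Proof.
  intros Hu Hr Hq.
  assert (Hb : forall n, u n <= u 0%nat * q ^ n).
  { induction n as [| n IH]; simpl; [lra |].
    apply Rle_trans with (1 := Hr n). apply Rmult_le_compat_l with (r := q) in IH; lra. }
  assert (Hq' : Rabs q < 1) by (rewrite Rabs_right; lra).
  assert (Hex : ex_series (fun n => u 0%nat * q ^ n)).
  { apply (ex_series_scal (K := R_AbsRing) (V := R_NormedModule)).
    exists (/ (1 - q)). now apply is_series_geom. }
  split.
  - apply (ex_series_le (K := R_AbsRing) (V := R_CompleteNormedModule) _ _) with (2 := Hex).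
    intros n. unfold norm; simpl; unfold abs; simpl. rewrite Rabs_right; auto.
    now apply Rle_ge.
  - unfold Rdiv. rewrite <- (Series_geom q Hq'), <- Series_scal_l.
    apply Series_le; auto.
Qed.

Definition zcrit (nu : R) : R := (5 - 2 * nu) / 4.

(** The factor [nu (nu + 1)] clears the denominators of the first three terms of
    the series, which then add up to a polynomial in [nu]. *)
Definition scaled_crossing (nu : R) : R := nu * (nu + 1) * crossing nu (zcrit nu).

Definition head (nu : R) : R := 5 / 4 * nu ^ 3 - nu ^ 2 / 8 - 5 / 16 * nu - 15 / 32.

Definition step (nu : R) (k : nat) : R := zcrit nu / ((INR k + 4) * (nu + INR k + 3)).

(** [weight nu k] is [nu (nu + 1) z^(k+3) / ((k+3)! (nu)_(k+3))] at
    [z = zcrit nu]. Building it from successive ratios makes its size, its variation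
    in [nu] and its exact values accessible by induction on [k]. *)
Fixpoint weight (nu : R) (k : nat) : R :=
  match k with
  | O => zcrit nu ^ 3 / (6 * (nu + 2))
  | S j => weight nu j * step nu j
  end.

Definition tail (nu : R) (k : nat) : R := (2 * INR k + 3 + 2 * nu) * weight nu k.

Lemma weight_eq (nu : R) (k : nat) : 0 < nu ->
  weight nu k = nu * (nu + 1) * phi_coef nu (3 + k) * zcrit nu ^ (3 + k).
Proof.
  intros Hnu. induction k as [| k IH].
  - unfold phi_coef; simpl. field. lra.
  - simpl weight. unfold step. rewrite IH. pose proof (phi_coef_succ nu (3 + k) Hnu) as Hs.
    pose proof (pos_INR k) as Hk.
    replace (3 + S k)%nat with (S (3 + k)) by lia.
    rewrite <- Hs, S_INR, plus_INR. simpl (INR 3). simpl pow. field. lra.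
Qed.

Lemma is_series_entire (a : nat -> R) (z : R) : CV_radius a = p_infty ->
  is_series (fun k => a k * z ^ k) (PSeries a z).
Proof.
  intros H. apply (proj1 (is_pseries_R a z (PSeries a z))), PSeries_correct.
  now apply ex_pseries_of_entire.
Qed.

Lemma is_series_crossing (nu z : R) : 0 < nu ->
  is_series (fun k => (2 * INR k - (3 - 2 * nu)) * phi_coef nu k * z ^ k) (crossing nu z).
Proof.
  intros Hnu. assert (HR := CV_radius_phi nu Hnu).
  pose proof (is_series_entire (PS_incr_1 (PS_derive (phi_coef nu))) z
    ltac:(now rewrite CV_radius_incr_1, CV_radius_derive)) as H1.
  pose proof (is_series_entire (phi_coef nu) z HR) as H0.
  rewrite PSeries_incr_1 in H1.
  apply (is_series_scal (K := R_AbsRing) (V := R_NormedModule) 2) in H1.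
  apply (is_series_scal (K := R_AbsRing) (V := R_NormedModule) (- (3 - 2 * nu))) in H0.
  pose proof (is_series_plus (K := R_AbsRing) (V := R_NormedModule) _ _ _ _ H1 H0) as H.
  replace (crossing nu z) with
    (2 * (z * PSeries (PS_derive (phi_coef nu)) z) + - (3 - 2 * nu) * PSeries (phi_coef nu) z)
    by (unfold crossing, dphi, phi; ring).
  revert H. apply is_series_ext. intros [| n].
  - change (2 * (0 * z ^ 0) + - (3 - 2 * nu) * (phi_coef nu 0 * z ^ 0)
      = (2 * INR 0 - (3 - 2 * nu)) * phi_coef nu 0 * z ^ 0). simpl INR. ring.
  - change (2 * (INR (S n) * phi_coef nu (S n) * z ^ S n)
      + - (3 - 2 * nu) * (phi_coef nu (S n) * z ^ S n)
      = (2 * INR (S n) - (3 - 2 * nu)) * phi_coef nu (S n) * z ^ S n). ring.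
Qed.

Lemma scaled_crossing_eq (nu : R) : 0 < nu ->
  scaled_crossing nu = head nu + Series (tail nu).
Proof.
  intros Hnu. unfold scaled_crossing.
  pose proof (is_series_crossing nu (zcrit nu) Hnu) as Hs.
  rewrite <- (is_series_unique _ _ Hs).
  rewrite (Series_incr_n _ 3); [| lia | eexists; exact Hs].
  rewrite Rmult_plus_distr_l. f_equal.
  - unfold head, phi_coef, zcrit. simpl. field. lra.
  - rewrite <- Series_scal_l. apply Series_ext. intros k.
    unfold tail. rewrite weight_eq, plus_INR by auto. simpl (INR 3). ring.
Qed.

Lemma weight_pos (nu : R) (k : nat) : 1 / 2 <= nu <= 3 / 2 -> 0 < weight nu k.
Proof.
  intros Hnu. assert (0 < zcrit nu) by (unfold zcrit; lra).
  induction k as [| k IH]; simpl weight.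
  - apply Rdiv_lt_0_compat; [now apply (pow_lt _ 3) | lra].
  - pose proof (pos_INR k). apply Rmult_lt_0_compat; auto. unfold step.
    apply Rdiv_lt_0_compat; auto. apply Rmult_lt_0_compat; lra.
Qed.

Lemma weight_succ (nu : R) (k : nat) : weight nu (S k) = weight nu k * step nu k.
Proof. reflexivity. Qed.

Lemma step_bounds (nu : R) (k : nat) : 1 / 2 <= nu <= 3 / 2 -> 0 <= step nu k <= 1 / 14.
Proof.
  intros Hnu. assert (0 < zcrit nu <= 1) by (unfold zcrit; lra). pose proof (pos_INR k).
  assert (14 <= (INR k + 4) * (nu + INR k + 3)) by nra.
  unfold step. split.
  - apply Rmult_le_pos; [lra |]. left; apply Rinv_0_lt_compat; lra.
  - apply Rmult_le_compat; try lra; [left; apply Rinv_0_lt_compat; lra |].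
    apply Rinv_le_contravar; lra.
Qed.

Lemma tail_pos (nu : R) (k : nat) : 1 / 2 <= nu <= 3 / 2 -> 0 < tail nu k.
Proof.
  intros Hnu. pose proof (pos_INR k).
  apply Rmult_lt_0_compat; [lra | now apply weight_pos].
Qed.

Lemma tail_succ_le (nu : R) (k : nat) : 1 / 2 <= nu <= 3 / 2 ->
  tail nu (S k) <= 3 / 28 * tail nu k.
Proof.
  intros Hnu. unfold tail. rewrite weight_succ, S_INR.
  pose proof (pos_INR k). pose proof (weight_pos nu k Hnu). pose proof (step_bounds nu k Hnu).
  assert (weight nu k * step nu k <= weight nu k * (1 / 14))
    by (apply Rmult_le_compat_l; lra).
  apply Rle_trans with ((2 * (INR k + 1) + 3 + 2 * nu) * (weight nu k * (1 / 14))).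
  - apply Rmult_le_compat_l; lra.
  - nra.
Qed.

Lemma tail_sum_le (nu : R) (n : nat) : 1 / 2 <= nu <= 3 / 2 ->
  ex_series (fun k => tail nu (n + k)) /\
  Series (fun k => tail nu (n + k)) <= 28 / 25 * tail nu n.
Proof.
  intros Hnu.
  destruct (Series_le_geometric (fun k => tail nu (n + k)) (3 / 28)) as [H1 H2].
  - intros k. left. now apply tail_pos.
  - intros k. replace (n + S k)%nat with (S (n + k)) by lia. now apply tail_succ_le.
  - lra.
  - split; auto. rewrite Nat.add_0_r in H2. lra.
Qed.

Lemma tail_sum_split (nu : R) (n : nat) : 1 / 2 <= nu <= 3 / 2 ->
  Series (tail nu) = sum_f_R0 (tail nu) n + Series (fun k => tail nu (S n + k)).
Proof.
  intros Hnu. apply (Series_incr_n (tail nu) (S n)); [lia |].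
  exact (proj1 (tail_sum_le nu 0 Hnu)).
Qed.

Lemma Series_pos_tail (nu : R) (n : nat) : 1 / 2 <= nu <= 3 / 2 ->
  0 <= Series (fun k => tail nu (n + k)).
Proof.
  intros Hnu. rewrite <- (Rmult_0_l (Series (fun k => tail nu (n + k)))), <- Series_scal_l.
  apply Series_le.
  - intros k. pose proof (tail_pos nu (n + k) Hnu). lra.
  - exact (proj1 (tail_sum_le nu n Hnu)).
Qed.

(** The margin is about [6 * 10^-10], which needs the terms of the tail up to
    index 5. *)
Lemma scaled_crossing_hi : 0 < scaled_crossing 0.784497765.
Proof.
  rewrite scaled_crossing_eq by lra.
  rewrite (tail_sum_split _ 5) by lra.
  pose proof (Series_pos_tail 0.784497765 6 ltac:(lra)).
  enough (0 < head 0.784497765 + sum_f_R0 (tail 0.784497765) 5) by lra.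
  unfold head, tail, weight, step, zcrit, sum_f_R0. simpl INR. lra.
Qed.

Lemma scaled_crossing_lo : scaled_crossing 0.784497755 < 0.
Proof.
  rewrite scaled_crossing_eq by lra.
  rewrite (tail_sum_split _ 4) by lra.
  pose proof (proj2 (tail_sum_le 0.784497755 5 ltac:(lra))).
  enough (head 0.784497755 + sum_f_R0 (tail 0.784497755) 4
    + 28 / 25 * tail 0.784497755 5 < 0) by lra.
  unfold head, tail, weight, step, zcrit, sum_f_R0. simpl INR. lra.
Qed.

(** The cubic is at most its value [-0.32] at [7/10], and the tail is below
    [0.31]. *)
Lemma scaled_crossing_neg (nu : R) : 1 / 2 < nu <= 7 / 10 -> scaled_crossing nu < 0.
Proof.
  intros Hnu. rewrite scaled_crossing_eq by lra.
  pose proof (proj2 (tail_sum_le nu 0 ltac:(lra))) as H. simpl in H.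
  assert (tail nu 0 <= 44 / 162).
  { unfold tail. simpl. unfold zcrit.
    set (z := (5 - 2 * nu) / 4).
    assert (Hz : 0 <= z <= 1) by (unfold z; lra).
    assert (z * (z * (z * 1)) <= 1) by nra.
    apply Rmult_le_reg_r with (6 * (nu + 2)); [lra |].
    replace ((2 * 0 + 3 + 2 * nu) * (z * (z * (z * 1)) / (6 * (nu + 2))) * (6 * (nu + 2)))
      with ((3 + 2 * nu) * (z * (z * (z * 1)))) by (field; lra). nra. }
  assert (head nu <= - 32 / 100).
  { unfold head. nra. }
  change (Series (fun k => tail nu k)) with (Series (tail nu)) in H. lra.
Qed.

Lemma weight_le (nu : R) (k : nat) : 1 / 2 <= nu <= 3 / 2 ->
  weight nu k <= 1 / 15 * (1 / 14) ^ k.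
Proof.
  intros Hnu. induction k as [| k IH].
  - simpl. assert (Hz : 0 < zcrit nu <= 1) by (unfold zcrit; lra).
    assert (zcrit nu * (zcrit nu * (zcrit nu * 1)) <= 1) by nra.
    apply Rmult_le_reg_r with (6 * (nu + 2)); [lra |].
    unfold Rdiv at 1. rewrite Rmult_assoc, Rinv_l by lra. lra.
  - rewrite weight_succ. simpl pow.
    pose proof (step_bounds nu k Hnu). pose proof (weight_pos nu k Hnu).
    apply Rle_trans with (weight nu k * (1 / 14)); [apply Rmult_le_compat_l |]; lra.
Qed.

Lemma step_diff (x y : R) (k : nat) : 1 / 2 <= x -> x <= y -> y <= 3 / 2 ->
  0 <= step x k - step y k <= (y - x) / 17.
Proof.
  intros Hx Hxy Hy. pose proof (pos_INR k) as Hk. unfold step, zcrit.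
  set (n := INR k) in *.
  replace ((5 - 2 * x) / 4 / ((n + 4) * (x + n + 3)) - (5 - 2 * y) / 4 / ((n + 4) * (y + n + 3)))
    with ((y - x) * ((11 + 2 * n) / 4 / ((n + 4) * (x + n + 3) * (y + n + 3))))
    by (field; repeat split; lra).
  assert (Hd : 0 < (n + 4) * (x + n + 3) * (y + n + 3))
    by (repeat apply Rmult_lt_0_compat; lra).
  split.
  - apply Rmult_le_pos; [lra |]. apply Rmult_le_pos; [lra |].
    left; now apply Rinv_0_lt_compat.
  - apply Rmult_le_compat_l; [lra |].
    apply Rmult_le_reg_r with (1 := Hd).
    unfold Rdiv at 1. rewrite Rmult_assoc, Rinv_l by lra.
    assert (14 * (n + 7/2) <= (n + 4) * (x + n + 3) * (y + n + 3)); [| lra].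
    apply Rmult_le_compat; nra.
Qed.

(** Each ratio [step] is at most [1/14] and has Lipschitz constant at most
    [1/17], so the Lipschitz constants of the weights decay geometrically. *)
Lemma weight_diff (x y : R) (k : nat) : 1 / 2 <= x -> x <= y -> y <= 3 / 2 ->
  0 <= weight x k - weight y k <= 13 / 100 * (1 / 9) ^ k * (y - x).
Proof.
  intros Hx Hxy Hy. induction k as [| k IH].
  - assert (Hu : zcrit x = zcrit y + (y - x) / 2) by (unfold zcrit; field).
    assert (Hx1 : zcrit x <= 1) by (unfold zcrit; lra).
    assert (Hv : 1 / 2 <= zcrit y) by (unfold zcrit; lra).
    simpl weight. simpl pow. set (u := zcrit x) in *. set (v := zcrit y) in *.
    replace (u * (u * (u * 1)) / (6 * (x + 2)) - v * (v * (v * 1)) / (6 * (y + 2)))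
      with ((y - x) * ((u ^ 3 + (u ^ 2 + u * v + v ^ 2) / 2 * (x + 2))
              / (6 * (x + 2) * (y + 2)))).
    2: { replace (y - x) with (2 * (u - v)) at 1 by lra.
         transitivity (((y - x) * u ^ 3 + 2 * (u - v) * ((u ^ 2 + u * v + v ^ 2) / 2 * (x + 2)))
              / (6 * (x + 2) * (y + 2))).
         - rewrite Hu. field. lra.
         - field. lra. }
    assert (Hden : 0 < 6 * (x + 2) * (y + 2)) by (repeat apply Rmult_lt_0_compat; lra).
    assert (Hu2 : 0 <= u ^ 2 <= 1) by nra. assert (Hv2 : 0 <= v ^ 2 <= 1) by nra.
    assert (Huv : 0 <= u * v <= 1) by nra. assert (Hu3 : 0 <= u ^ 3 <= 1) by (simpl; nra).
    split.
    + apply Rmult_le_pos; [lra |]. apply Rmult_le_pos; [| left; now apply Rinv_0_lt_compat].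
      apply Rplus_le_le_0_compat; [lra |]. apply Rmult_le_pos; lra.
    + rewrite Rmult_1_r, Rmult_comm. apply Rmult_le_compat_r; [lra |].
      apply Rmult_le_reg_r with (1 := Hden).
      unfold Rdiv at 1. rewrite Rmult_assoc, Rinv_l by lra.
      assert ((u ^ 2 + u * v + v ^ 2) / 2 * (x + 2) <= 3 / 2 * (x + 2))
        by (apply Rmult_le_compat_r; lra).
      assert (6 * (x + 2) * (5 / 2) <= 6 * (x + 2) * (y + 2))
        by (apply Rmult_le_compat_l; lra).
      lra.
  - rewrite !weight_succ. simpl pow.
    pose proof (step_bounds x k ltac:(lra)) as Hs. pose proof (step_diff x y k Hx Hxy Hy) as Hd.
    pose proof (weight_pos y k ltac:(lra)) as Hw. pose proof (weight_le y k ltac:(lra)) as Hle.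
    assert (Hpow : (1 / 14) ^ k <= (1 / 9) ^ k) by (apply pow_incr; lra).
    assert (Hpos : 0 < (1 / 9) ^ k) by (apply pow_lt; lra).
    set (e := (1 / 9) ^ k) in *.
    replace (weight x k * step x k - weight y k * step y k)
      with ((weight x k - weight y k) * step x k + weight y k * (step x k - step y k)) by ring.
    split.
    + apply Rplus_le_le_0_compat; apply Rmult_le_pos; lra.
    + assert ((weight x k - weight y k) * step x k <= 13 / 100 * e * (y - x) * (1 / 14))
        by (apply Rmult_le_compat; lra).
      assert (weight y k * (step x k - step y k) <= (1 / 15 * e) * ((y - x) / 17))
        by (apply Rmult_le_compat; lra).
      assert (0 <= e * (y - x)) by (apply Rmult_le_pos; lra).
      nra.
Qed.

(** The affine factor increases with [nu] and the weight decreases; the variation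
    of the product is bounded in each direction by that of one factor. *)
Lemma tail_diff (x y : R) (k : nat) : 1 / 2 <= x -> x <= y -> y <= 3 / 2 ->
  Rabs (tail x k - tail y k) <= (1 / 6) ^ k * (y - x).
Proof.
  intros Hx Hxy Hy. unfold tail. pose proof (pos_INR k) as Hk.
  pose proof (weight_diff x y k Hx Hxy Hy) as Hd.
  pose proof (weight_pos y k ltac:(lra)) as Hw. pose proof (weight_le y k ltac:(lra)) as Hle.
  assert (Hpow : (1 / 14) ^ k <= (1 / 6) ^ k) by (apply pow_incr; lra).
  assert (Hpow9 : (1 / 9) ^ k * (1 + INR k * (1 / 3)) <= (1 / 6) ^ k).
  { replace (1 / 6) with (1 / 9 * (3 / 2)) by field. rewrite Rpow_mult_distr.
    assert (0 < (1 / 9) ^ k) by (apply pow_lt; lra).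
    apply Rmult_le_compat_l; [lra |].
    (* Bernoulli's inequality. *)
    apply Rle_trans with ((1 + 1 / 3) ^ k); [apply poly; lra | apply pow_incr; lra]. }
  set (n := INR k) in *. set (e := (1 / 9) ^ k) in *. set (f := (1 / 6) ^ k) in *.
  replace ((2 * n + 3 + 2 * x) * weight x k - (2 * n + 3 + 2 * y) * weight y k)
    with ((2 * n + 3 + 2 * x) * (weight x k - weight y k) - 2 * (y - x) * weight y k) by ring.
  assert (H1 : 0 <= (2 * n + 3 + 2 * x) * (weight x k - weight y k)
                 <= (2 * n + 6) * (13 / 100 * e * (y - x))).
  { split; [apply Rmult_le_pos | apply Rmult_le_compat]; lra. }
  assert (H2 : 0 <= (y - x) * weight y k <= (y - x) * (1 / 15 * f)).
  { split; [apply Rmult_le_pos | apply Rmult_le_compat_l]; lra. }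
  assert (H3 : (y - x) * (e * (1 + n * (1 / 3))) <= (y - x) * f)
    by (apply Rmult_le_compat_l; lra).
  assert (0 <= (y - x) * f).
  { apply Rmult_le_pos; [lra |]. unfold f. apply pow_le; lra. }
  apply Rabs_le. split; lra.
Qed.

Lemma tail_sum_diff (x y : R) : 1 / 2 <= x -> x <= y -> y <= 3 / 2 ->
  Rabs (Series (tail x) - Series (tail y)) <= 6 / 5 * (y - x).
Proof.
  intros Hx Hxy Hy.
  assert (Ex : ex_series (tail x)) by exact (proj1 (tail_sum_le x 0 ltac:(lra))).
  assert (Ey : ex_series (tail y)) by exact (proj1 (tail_sum_le y 0 ltac:(lra))).
  assert (Hq : Rabs (1 / 6) < 1) by (rewrite Rabs_right; lra).
  assert (Eg : ex_series (fun k => (1 / 6) ^ k * (y - x))).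
  { apply (ex_series_scal_r (y - x)). exists (/ (1 - 1 / 6)). now apply is_series_geom. }
  assert (Ea : ex_series (fun k => Rabs (tail x k - tail y k))).
  { apply (ex_series_le (K := R_AbsRing) (V := R_CompleteNormedModule) _ _) with (2 := Eg).
    intros k. unfold norm; simpl; unfold abs; simpl. rewrite Rabs_Rabsolu.
    now apply tail_diff. }
  rewrite <- Series_minus by auto.
  apply Rle_trans with (1 := Series_Rabs _ Ea).
  replace (6 / 5 * (y - x)) with (Series (fun k => (1 / 6) ^ k * (y - x))).
  - apply Series_le; auto. intros k. split; [apply Rabs_pos | now apply tail_diff].
  - rewrite (Series_scal_r (y - x) (fun k => (1 / 6) ^ k)), (Series_geom (1 / 6) Hq). field.
Qed.

(** The cubic part has slope at least [1.35] on this range, while the tail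
    has Lipschitz constant at most [6/5]. *)
Lemma scaled_crossing_lt (x y : R) : 7 / 10 <= x -> x < y -> y <= 3 / 2 ->
  scaled_crossing x < scaled_crossing y.
Proof.
  intros Hx Hxy Hy. rewrite !scaled_crossing_eq by lra.
  pose proof (tail_sum_diff x y ltac:(lra) ltac:(lra) Hy) as Ht.
  apply Rabs_le_between in Ht.
  replace (head y) with (head x + (y - x) *
    (5 / 4 * (x ^ 2 + x * y + y ^ 2) - (x + y) / 8 - 5 / 16)) by (unfold head; field).
  assert (135 / 100 <= 5 / 4 * (x ^ 2 + x * y + y ^ 2) - (x + y) / 8 - 5 / 16) by nra.
  nra.
Qed.

Lemma continuity_scaled_crossing (x : R) : 1 / 2 < x < 3 / 2 ->
  continuity_pt scaled_crossing x.
Proof.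
  intros Hx.
  apply (continuity_pt_locally_ext (fun t => head t + Series (tail t)) _
    (Rmin (x - 1 / 2) (3 / 2 - x))).
  - apply Rmin_pos; lra.
  - intros t Ht. unfold R_dist in Ht.
    pose proof (Rmin_l (x - 1 / 2) (3 / 2 - x)). apply Rabs_def2 in Ht.
    symmetry. apply scaled_crossing_eq. lra.
  - apply continuity_pt_plus.
    + unfold head. reg.
    + intros eps Heps. exists (Rmin (Rmin (x - 1 / 2) (3 / 2 - x)) (eps / 2)). split.
      * apply Rmin_pos; [apply Rmin_pos |]; lra.
      * intros t [_ Ht]. simpl in *. unfold R_dist in *.
        pose proof (Rmin_l (x - 1 / 2) (3 / 2 - x)). pose proof (Rmin_r (x - 1 / 2) (3 / 2 - x)).
        pose proof (Rmin_l (Rmin (x - 1 / 2) (3 / 2 - x)) (eps / 2)).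
        pose proof (Rmin_r (Rmin (x - 1 / 2) (3 / 2 - x)) (eps / 2)).
        apply Rabs_def2 in Ht.
        destruct (Rle_lt_dec t x) as [H' | H'].
        -- pose proof (tail_sum_diff t x ltac:(lra) H' ltac:(lra)). lra.
        -- rewrite Rabs_minus_sym.
           pose proof (tail_sum_diff x t ltac:(lra) ltac:(lra) ltac:(lra)). lra.
Qed.

Lemma crossing_eq_0_iff (nu : R) : 0 < nu ->
  (crossing nu ((5 - 2 * nu) / 4) = 0 <-> scaled_crossing nu = 0).
Proof.
  intros Hnu. assert (Hp : 0 < nu * (nu + 1)) by (apply Rmult_lt_0_compat; lra).
  unfold scaled_crossing, zcrit. split; intros H.
  - rewrite H. ring.
  - apply Rmult_integral in H. destruct H; lra.
Qed.

Lemma crossing_nonneg_iff (nu : R) : 0 < nu ->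
  (0 <= crossing nu ((5 - 2 * nu) / 4) <-> 0 <= scaled_crossing nu).
Proof.
  intros Hnu. assert (Hp : 0 < nu * (nu + 1)) by (apply Rmult_lt_0_compat; lra).
  unfold scaled_crossing, zcrit. split; intros H.
  - apply Rmult_le_pos; lra.
  - apply Rmult_le_reg_l with (1 := Hp). lra.
Qed.

Theorem theorem2 :
  exists nu0 : R,
    unique (fun nu : R =>
      1 / 2 < nu < 3 / 2 /\
      besselI nu (sqrt (5 - 2 * nu)) / besselI (nu - 1) (sqrt (5 - 2 * nu))
        = (3 - 2 * nu) / sqrt (5 - 2 * nu)) nu0 /\
    Rabs (nu0 - 0.78449776) < 5 / 10 ^ 9 /\
    (forall nu : R, 0 < nu ->
      ((forall a : R, 0 <= a ->
          log_concave_on (fun t => 0 < t) (fun t => marcum_integrand nu a t))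
       <-> nu0 <= nu)).
Proof.
  destruct (IVT_interv scaled_crossing 0.784497755 0.784497765) as (nu0 & Hint & Hzero).
  { intros t Ht. apply continuity_scaled_crossing; lra. }
  { lra. }
  { exact scaled_crossing_lo. }
  { exact scaled_crossing_hi. }
  assert (Hlo : nu0 <> 0.784497755).
  { intros ->. pose proof scaled_crossing_lo. lra. }
  assert (Hhi : nu0 <> 0.784497765).
  { intros ->. pose proof scaled_crossing_hi. lra. }
  assert (Hneg : forall nu, 1 / 2 < nu -> nu < nu0 -> scaled_crossing nu < 0).
  { intros nu H1 H2. destruct (Rle_lt_dec nu (7 / 10)).
    - apply scaled_crossing_neg; lra.
    - rewrite <- Hzero. apply scaled_crossing_lt; lra. }
  assert (Hpos : forall nu, nu0 < nu -> nu <= 3 / 2 -> 0 < scaled_crossing nu).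
  { intros nu H1 H2. rewrite <- Hzero. apply scaled_crossing_lt; lra. }
  exists nu0. split; [split; [split; [lra |] |] | split].
  - apply bessel_equation_iff, crossing_eq_0_iff; lra.
  - intros nu [Hnu Heq].
    apply bessel_equation_iff, crossing_eq_0_iff in Heq; [| lra | exact Hnu].
    destruct (Rtotal_order nu0 nu) as [H | [H | H]]; auto.
    + pose proof (Hpos nu H ltac:(lra)). lra.
    + pose proof (Hneg nu ltac:(lra) H). lra.
  - apply Rabs_def1; lra.
  - intros nu Hnu. rewrite log_concave_iff_defect by auto. split.
    + intros Hd.
      destruct (Rle_lt_dec nu0 nu) as [| Hlt]; auto. exfalso.
      destruct (Rle_lt_dec nu (1 / 2)) as [Hsmall | Hbig].
      * destruct (defect_neg_of_le nu ltac:(lra)) as (z & Hz & Hneg').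
        specialize (Hd z Hz). lra.
      * apply defect_nonneg_iff_crossing, crossing_nonneg_iff in Hd; [| lra | lra].
        pose proof (Hneg nu Hbig Hlt). lra.
    + intros Hle. destruct (Rle_lt_dec (3 / 2) nu) as [Hbig | Hsmall].
      * intros z Hz. now apply defect_nonneg_of_ge.
      * apply defect_nonneg_iff_crossing; [lra |]. apply crossing_nonneg_iff; [lra |].
        destruct Hle as [Hlt | <-]; [left; apply Hpos; lra | lra].
Qed.
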